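(* Let $n\ge 3$ and let $\mathcal{F}$ be a family of subsets of $[n]$. Assume that there are no 6 different sets $A,B_1,B_2,B_3,B_4,C\in\mathcal{F}$ such that $A\subset B_i\subset C$ for all $1\le i\le 4$ and $|B_1|=|B_2|=|B_3|=|B_4|$. Then $|\mathcal{F}|\le\Sigma(n,4)$. Moreover, this bound is best possible: there is a family of subsets of $[n]$ of size $\Sigma(n,4)$ (namely all subsets of $[n]$ lying in the 4 middle levels) containing no such configuration.
   Context: $[n]=\{1,2,\dots,n\}$. For integers $n,k$, $\Sigma(n,k)=\sum_{i=\lceil\frac{n-k}{2}\rceil}^{\lceil\frac{n+k}{2}\rceil-1}\binom{n}{i}$ denotes the sum of the $k$ largest binomial coefficients $\binom{n}{i}$, i.e. the number of subsets of $[n]$ in the $k$ middle levels. *)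

(* Defs.v *)
From mathcomp Require Import all_boot.

Set Implicit Arguments.
Unset Strict Implicit.
Unset Printing Implicit Defensive.

(* The ground set {1, ..., n} is represented by 'I_n. *)

(* [uphalf m] is the ceiling of m / 2. When n < k the subtraction is truncated,
   so the sum starts at 0; the terms dropped have a negative lower index and
   their binomial coefficients vanish. *)
Definition Sigma (n k : nat) : nat :=
  \sum_(uphalf (n - k) <= i < uphalf (n + k)) 'C(n, i).

Definition middle_levels (n k : nat) : {set {set 'I_n}} :=
  [set X : {set 'I_n} | uphalf (n - k) <= #|X| < uphalf (n + k)].

(* [uniq] makes the six sets pairwise distinct, so the inclusions are strict. *)
Definition has_configuration (n : nat) (F : {set {set 'I_n}}) : Prop :=
  exists (A C : {set 'I_n}) (B : 'I_4 -> {set 'I_n}),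
    [/\ uniq [:: A, C & codom B],
        {subset [:: A, C & codom B] <= F},
        forall i, A \subset B i /\ B i \subset C
      & forall i j, #|B i| = #|B j|].

(* Main.v *)
(* Encode the maximal chains of subsets by permutations and sort the chains that
   meet F according to the smallest and largest members A, C of F they contain.
   Inside such a class every set of level j between A and C lies on a fraction
   1 / 'C(m, j) of the chains, where m = #|C| - #|A|, and F has at most 3 members
   on each inner level.  As 2 + \sum_(0 < j < m) min(1, 3 / 'C(m, j)) <= 4, an
   average chain contains at most 4 members of F, which gives the LYM-type bound
   \sum_(X in F) 1 / 'C(n, #|X|) <= 4; the four middle levels attain equality in
   it and have the largest binomial coefficients. *)
Require Import Defs.
From mathcomp Require Import all_boot.
From mathcomp Require Import all_order fingroup perm all_algebra zify ring lra.

Set Implicit Arguments.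
Unset Strict Implicit.
Unset Printing Implicit Defensive.

(** * Unimodality of binomial coefficients *)

Lemma bin_middle_mono n i k : i <= k -> i + k <= n -> 'C(n, i) <= 'C(n, k).
Proof.
have step j : j.*2 < n -> 'C(n, j) <= 'C(n, j.+1).
  move=> lt_jn; have:= mul_bin_left n j.
  move=> /eqP; nia.
have mono p : i <= p -> p.*2 <= n -> 'C(n, i) <= 'C(n, p).
  elim: p => [|p IHp]; first by rewrite leqn0 => /eqP->.
  rewrite leq_eqVlt => /predU1P[-> //|lt_ip] le_pn.
  by apply: leq_trans (IHp _ _) (step _ _); lia.
(* Past the middle, [k] is reflected to [n - k], which is still at least [i] because
   [i + k <= n]. *)
move=> le_ik le_n; have [le_kn|lt_nk] := leqP k.*2 n; first exact: mono.
by rewrite -(bin_sub (n := n) (m := k)); [apply: mono; lia | lia].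
Qed.

(** * Maximal chains and their number through a given set *)

Section MaximalChains.

Variable n : nat.
Implicit Types (A C X Y : {set 'I_n}) (s t : 'S_n) (S : {set 'S_n}).

Definition initial s k : {set 'I_n} := s @: [set i : 'I_n | i < k].

(* A permutation [s] encodes the maximal chain of its sets of initial values. *)
Definition on_chain s X := X == initial s #|X|.

Lemma card_initial s k : k <= n -> #|initial s k| = k.
Proof.
move=> le_kn; rewrite card_imset; last exact: perm_inj.
rewrite -sum1dep_card -(big_ord_widen n (fun=> 1) le_kn) sum_nat_const card_ord.
by rewrite muln1.
Qed.

Lemma on_chain_initial s k : k <= n -> on_chain s (initial s k).
Proof. by move=> le_kn; rewrite /on_chain card_initial. Qed.

Lemma on_chain0 s : on_chain s set0.
Proof.
rewrite /on_chain cards0 eq_sym -subset0.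
by apply/subsetP => x /imsetP[i]; rewrite inE.
Qed.

Lemma on_chainT s : on_chain s setT.
Proof.
rewrite /on_chain cardsT card_ord eq_sym eqEcard subsetT card_initial //.
by rewrite cardsT card_ord leqnn.
Qed.

Lemma on_chain_sub s X Y :
  on_chain s X -> on_chain s Y -> #|X| <= #|Y| -> X \subset Y.
Proof.
move=> /eqP defX /eqP defY le_XY; rewrite defX defY.
by apply/imsetS/subsetP => i; rewrite !inE => lt_i; apply: leq_trans lt_i _.
Qed.

Lemma on_chainM s t X : on_chain (s * t)%g (t @: X) = on_chain s X.
Proof.
rewrite /on_chain card_imset; last exact: perm_inj.
have ->: initial (s * t)%g #|X| = t @: initial s #|X|.
  by rewrite /initial -imset_comp; apply: eq_imset => i; rewrite permM.
by rewrite (inj_eq (imset_inj (@perm_inj _ t))).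
Qed.

Lemma card_interval A C k : A \subset C -> #|A| <= k ->
  #|[set X : {set 'I_n} | [&& A \subset X, X \subset C & #|X| == k]]|
    = 'C(#|C| - #|A|, k - #|A|).
Proof.
move=> sAC le_Ak.
have <-: #|C :\: A| = #|C| - #|A| by rewrite cardsD (setIidPr sAC).
(* Adding [A] is a bijection from the subsets of [C :\: A] of size [k - #|A|] onto the interval
   level. *)
rewrite -cards_draws -[RHS](card_in_imset (f := fun X => A :|: X)); last first.
  move=> X Y; rewrite !inE !subsetD => /andP[/andP[_ dX] _] /andP[/andP[_ dY] _].
  move=> /(congr1 (fun Z => Z :\: A)); rewrite !setDUl setDv !set0U.
  by move: dX dY => /setDidPl-> /setDidPl->.
apply: eq_card => X; rewrite inE; apply/idP/imsetP.
  case/and3P=> sAX sXC /eqP cX; exists (X :\: A).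
    by rewrite inE setSD //= cardsD (setIidPr sAX) cX.
  by rewrite setDE setUIr setUCr setIT (setUidPr sAX).
case=> Y; rewrite inE subsetD => /andP[/andP[sYC dYA] /eqP cY] ->.
rewrite subsetUl subUset sAC sYC /= cardsU.
have -> : A :&: Y = set0 by apply/eqP; rewrite setI_eq0 disjoint_sym.
by rewrite cards0 cY subn0 subnKC.
Qed.

(* The transpositions of [C :\: A] act on the chains in [S] and move any set
   between [A] and [C] to any other one of the same size. *)
Lemma card_on_chain S A C X :
    {in S, forall s, on_chain s A && on_chain s C} ->
    (forall s x y, s \in S -> x \in C :\: A -> y \in C :\: A ->
       (s * tperm x y)%g \in S) ->
    A \subset X -> X \subset C ->
  #|[set s in S | on_chain s X]| * 'C(#|C| - #|A|, #|X| - #|A|) = #|S|.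
Proof.
move=> chS closedS sAX sXC; set k := #|X|.
pose N Y := #|[set s in S | on_chain s Y]|; rewrite -/(N X).
(* Swapping some [x] of [Y :\: Z] with some [y] of [Z :\: Y] brings [Y] closer to [Z], and
   multiplication by the transposition injects the chains through [Y] into those through its image.
   Used in both directions, this makes [N] constant on a level. *)
have N_le m Y Z : #|Y :\: Z| <= m -> A \subset Y -> Y \subset C ->
    A \subset Z -> Z \subset C -> #|Y| = #|Z| -> N Y <= N Z.
  elim: m Y => [|m IHm] Y leYZ sAY sYC sAZ sZC cYZ.
    suff /eqP->: Y == Z by [].
    by rewrite eqEcard cYZ leqnn andbT -setD_eq0 -cards_eq0 -leqn0.
  have [YZ0|[x]] := set_0Vmem (Y :\: Z).
    by apply: (IHm Y) => //; rewrite YZ0 cards0.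
  rewrite inE => /andP[xZ xY].
  have [y]: exists y, y \in Z :\: Y.
    apply/set0Pn; rewrite -card_gt0 cardsD setIC -cYZ -cardsD card_gt0.
    by apply/set0Pn; exists x; rewrite inE xZ.
  rewrite inE => /andP[yY yZ]; pose t := tperm x y.
  have inCA z : (z \in Y) || (z \in Z) -> ~~ ((z \in Y) && (z \in Z)) ->
      z \in C :\: A.
    rewrite inE => zYZ zNYZ; apply/andP; split.
      by apply: contra zNYZ => zA; rewrite (subsetP sAY) ?(subsetP sAZ).
    by case/orP: zYZ; [apply: (subsetP sYC) | apply: (subsetP sZC)].
  have xCA : x \in C :\: A by apply: inCA; rewrite ?xY ?(negPf xZ).
  have yCA : y \in C :\: A by apply: inCA; rewrite ?yZ ?(negPf yY) ?orbT.
  have tmem (D : {set 'I_n}) z : x \in D -> y \in D -> z \in D -> t z \in D.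
    by rewrite /t; case: tpermP.
  have sAtY : A \subset t @: Y.
    apply/subsetP=> z zA; apply/imsetP; exists z; first exact: (subsetP sAY).
    move: xCA yCA; rewrite !inE => /andP[xA _] /andP[yA _].
    by rewrite tpermD //; [apply: contraNneq xA => -> | apply: contraNneq yA => ->].
  have stYC : t @: Y \subset C.
    apply/subsetP=> _ /imsetP[z zY ->].
    move: xCA yCA; rewrite !inE => /andP[_ xC] /andP[_ yC].
    by apply: tmem => //; apply: (subsetP sYC).
  have ctY : #|t @: Y| = #|Y| by rewrite card_imset //; apply: perm_inj.
  apply: leq_trans (IHm (t @: Y) _ sAtY stYC sAZ sZC _); last 2 first.
  - have: #|Y :\: Z| = #|(Y :\: Z) :\ x|.+1.
      by rewrite (cardsD1 x (Y :\: Z)) !inE xZ xY.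
    move=> cYx; rewrite -ltnS; apply: leq_trans leYZ; rewrite cYx ltnS.
    apply/subset_leq_card/subsetP=> z; rewrite !inE => /andP[zZ /imsetP[w wY def_z]].
    move: zZ; rewrite def_z /t; case: tpermP => [_|defw|/eqP wx _] zZ.
    + by rewrite yZ in zZ.
    + by rewrite -defw wY in yY.
    + by rewrite wx zZ wY.
  - by rewrite ctY.
  rewrite /N -(card_imset _ (@mulIg _ t)); apply/subset_leq_card/subsetP=> s'.
  case/imsetP=> s; rewrite !inE => /andP[sS chs] ->.
  by rewrite on_chainM chs closedS.
have sAC := subset_trans sAX sXC.
have leAk : #|A| <= k by apply: subset_leq_card.
(* Double counting: every chain of [S] has exactly one set of size [k], and it lies between [A] and
   [C]. *)
rewrite -card_interval // mulnC -sum_nat_const.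
transitivity (\sum_(Y in [set Y : {set 'I_n} |
    [&& A \subset Y, Y \subset C & #|Y| == k]]) N Y).
  apply: eq_bigr => Y; rewrite inE => /and3P[sAY sYC /eqP cY].
  by apply/eqP; rewrite eqn_leq !(N_le n) // -[n in _ <= n]card_ord max_card.
transitivity (\sum_(s in S)
    #|[set Y : {set 'I_n} |
        [&& A \subset Y, Y \subset C & #|Y| == k] && on_chain s Y]|).
  rewrite /N; under eq_bigr do rewrite -sum1dep_card big_mkcondr.
  rewrite exchange_big; apply: eq_bigr => s _ /=.
  rewrite -sum1dep_card big_mkcondr /=.
  by apply: eq_bigl => Y; rewrite inE.
rewrite -sum1_card; apply: eq_bigr => s sS; have /andP[chA chC] := chS s sS.
have le_kn : k <= n by rewrite -[n]card_ord max_card.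
apply/eqP/cards1P; exists (initial s k); apply/setP=> Y; rewrite !inE.
apply/andP/eqP => [[/and3P[_ _ /eqP<-] /eqP//]|->].
rewrite on_chain_initial // card_initial // eqxx andbT; split=> //.
have chI := on_chain_initial s le_kn; have cI := card_initial s le_kn.
rewrite (on_chain_sub chA chI) ?cI // (on_chain_sub chI chC) ?cI //.
exact: subset_leq_card.
Qed.

End MaximalChains.

(** * Numerical estimates for the levels of an interval *)

Import Order.TTheory GRing.Theory Num.Theory.
Local Open Scope ring_scope.

(* With [m = p.+3], the summands bound the levels [1], [m.-1] and the [p] levels
   in between, whose binomial coefficients are at least ['C(m, 2)]. *)
Lemma bin_ratio_num p :
  3 / p.+3%:R + 3 / p.+3%:R + 3 / 'C(p.+3, 2)%:R *+ p <= 2 :> rat.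
Proof.
have -> : 'C(p.+3, 2)%:R = (p%:R + 3) * (p%:R + 2) / 2 :> rat.
  apply: (mulIf (_ : 2 != 0 :> rat)) => //; rewrite mulfVK // -natrM -!natrD.
  by rewrite -natrM; congr (_%:R); have := mul_bin_diag p.+3 1; rewrite /= bin1; nia.
have -> : p.+3%:R = p%:R + 3 :> rat by rewrite -natrD addn3.
(* With denominators cleared, the claim is exactly this inequality. It needs [p] to be an integer,
   and it is an equality for [p] equal to 0 or 1. *)
have pp : p%:R <= p%:R * p%:R :> rat by rewrite -natrM ler_nat; nia.
have p0 : 0 <= p%:R :> rat by rewrite ler0n.
rewrite -[X in _ + X]mulr_natr; move: (p%:R : rat) p0 pp => q q0 qq.
have q2 : q + 2 != 0 by rewrite gt_eqF //; lra.
have q3 : q + 3 != 0 by rewrite gt_eqF //; lra.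
have -> : 3 / (q + 3) + 3 / (q + 3) + 3 / ((q + 3) * (q + 2) / 2) * q
    = 12 * (q + 1) / ((q + 3) * (q + 2)).
  by field; rewrite q2 q3.
by rewrite ler_pdivrMr; nra.
Qed.

Lemma sum_bin_ratio_le4 m (f : nat -> nat) :
    (forall j, (f j <= 'C(m, j))%N) -> (forall j, (0 < j < m)%N -> (f j <= 3)%N) ->
  \sum_(j < m.+1) (f j)%:R / 'C(m, j)%:R <= 4 :> rat.
Proof.
move=> f_bin f_3.
have r1 j : (f j)%:R / 'C(m, j)%:R <= 1 :> rat.
  (* Beyond level [m] the coefficient is 0 and the quotient is 0 by convention. *)
  have [->|C_gt0] := posnP 'C(m, j); first by rewrite invr0 mulr0.
  by rewrite ler_pdivrMr ?ltr0n // mul1r ler_nat.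
have [lt_m3|le3m] := ltnP m 3.
  apply: le_trans (ler_sum _ (fun (j : 'I_m.+1) _ => r1 j)) _.
  by rewrite sumr_const card_ord ler_nat; lia.
have [p def_m] : exists p, m = p.+3 by exists (m - 3)%N; lia.
have r3 j c : (0 < j < m)%N -> (0 < c <= 'C(m, j))%N ->
    (f j)%:R / 'C(m, j)%:R <= 3 / c%:R :> rat.
  move=> jm /andP[c_gt0 le_c]; have C_gt0 := leq_trans c_gt0 le_c.
  apply: ler_pM; rewrite ?invr_ge0 ?ler0n // ?ler_nat ?f_3 //.
  by rewrite lef_pV2 ?posrE ?ltr0n // ler_nat.
have rm (j : nat) : (j == 1%N) || (j == m.-1) ->
    (f j)%:R / 'C(m, j)%:R <= 3 / m%:R :> rat.
  move=> j1m; apply: r3; first by lia.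
  by case/orP: j1m => /eqP->; rewrite ?bin1 ?bin_sub -?subn1 ?bin_sub ?bin1; lia.
have rmid j : (1 < j < m.-1)%N ->
    (f j)%:R / 'C(m, j)%:R <= 3 / 'C(m, 2)%:R :> rat.
  move=> jm; apply: r3; first by lia.
  by rewrite bin_gt0 bin_middle_mono; lia.
move: r1 rm rmid; rewrite def_m => r1 rm rmid.
(* Levels 0 and [m] contribute at most 1 each; the inner levels contribute at most 2 together. *)
rewrite 2!big_ord_recl 2!big_ord_recr /=.
have r0 := r1 0%N; have rp3 := r1 p.+3; have r1' := rm 1%N isT.
have rp2 : (f p.+2)%:R / 'C(p.+3, p.+2)%:R <= 3 / p.+3%:R :> rat.
  by apply: rm; rewrite eqxx orbT.
have rsum : \sum_(i < p) (f (bump 0 (bump 0 i)))%:R / 'C(p.+3, bump 0 (bump 0 i))%:R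
    <= 3 / 'C(p.+3, 2)%:R *+ p :> rat.
  rewrite -[X in _ *+ X]card_ord -sumr_const; apply: ler_sum => i _.
  by apply: rmid; rewrite /bump /=; have := ltn_ord i; lia.
have num := bin_ratio_num p.
apply: le_trans (lerD r0 (lerD r1' (lerD (lerD rsum rp2) rp3))) _.
by move: (3 / p.+3%:R) (_ *+ p) num => u v; clear; lra.
Qed.

(** * Auxiliary facts on families and their levels *)

Lemma sum_by_card n (G : {set {set 'I_n}}) (g : nat -> rat) lo hi :
    (forall X, X \in G -> (lo <= #|X| < hi)%N) ->
  \sum_(X in G) g #|X| =
    \sum_(lo <= k < hi) #|[set X in G | #|X| == k]|%:R * g k.
Proof.
move=> G_lohi.
under [RHS]eq_bigr => k _ do rewrite -sum1dep_card natr_sum mulr_suml big_mkcondr.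
rewrite exchange_big /=; apply: eq_bigr => X XG.
under eq_bigr do rewrite mul1r.
rewrite -big_mkcond /= (eq_bigl (pred1 #|X|)); last by move=> k; rewrite /= eq_sym.
by rewrite big_nat1_eq G_lohi.
Qed.

Lemma tperm_imset (T : finType) (x y : T) (X : {set T}) :
  (x \in X) = (y \in X) -> tperm x y @: X = X.
Proof.
move=> xyX; apply/eqP; rewrite eqEcard card_imset ?leqnn ?andbT; last exact: perm_inj.
by apply/subsetP=> _ /imsetP[z zX ->]; case: tpermP zX => [->|->|//]; rewrite xyX.
Qed.

(** Four sets on such a level would complete [A] and [C] to a configuration; the strict bounds on
    [k] keep them different from [A] and [C]. *)
Lemma configuration_free_level n (F : {set {set 'I_n}}) A C k :
    ~ has_configuration F -> A \in F -> C \in F -> (#|A| < k < #|C|)%N ->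
  (#|[set X in F | [&& A \subset X, X \subset C & #|X| == k]]| <= 3)%N.
Proof.
move=> freeF AF CF /andP[ltAk ltkC]; rewrite leqNgt; apply/negP.
set G := finset _ => G4; apply: freeF.
pose B (i : 'I_4) : {set 'I_n} := enum_val (widen_ord G4 i).
have BG i : B i \in G by apply: enum_valP.
have cB i : #|B i| = k by have:= BG i; rewrite inE => /and4P[_ _ _ /eqP].
have B_neq (D : {set 'I_n}) : #|D| <> k -> D \notin codom B.
  by move=> cD; apply/codomP => -[i defD]; apply: cD; rewrite defD.
exists A, C, B; split.
- rewrite /= inE negb_or !B_neq; [|lia|lia].
  rewrite map_inj_uniq ?enum_uniq ?andbT.
    by apply/eqP => defA; move: ltAk; rewrite defA; lia.
  by move=> i j /enum_val_inj/(congr1 val) /= eq_ij; apply: val_inj.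
- move=> D; rewrite !inE => /or3P[/eqP->|/eqP->|/codomP[i ->]] //.
  by have:= BG i; rewrite inE => /andP[].
- by move=> i; have:= BG i; rewrite inE => /and4P[].
- by move=> i j; rewrite !cB.
Qed.

(** * The LYM-type inequality for configuration-free families *)

Section ConfigurationFree.

Variables (n : nat) (F : {set {set 'I_n}}).

(** For [A] and [C] in [F], these are the chains whose smallest and largest members of [F] are [A]
    and [C]. *)
Definition chains_between (A C : {set 'I_n}) : {set 'S_n} :=
  [set s | [&& on_chain s A, on_chain s C
     & [forall X in F, on_chain s X ==> (A \subset X) && (X \subset C)]]].

(* A member of [F] on the new chain need not come from one on the old chain, but
   if it is not between [A] and [C], then the transposition fixes it. *)
Lemma chains_between_tperm A C s x y :
    s \in chains_between A C -> A \subset C -> x \in C :\: A -> y \in C :\: A ->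
  (s * tperm x y)%g \in chains_between A C.
Proof.
rewrite !inE => /and3P[chA chC /forall_inP sF] sAC /andP[xA xC] /andP[yA yC].
have tF (D : {set 'I_n}) : (x \in D) = (y \in D) ->
    on_chain (s * tperm x y)%g D = on_chain s D.
  by move=> xyD; rewrite -{1}(tperm_imset xyD) on_chainM.
have [chA' chC'] : on_chain (s * tperm x y)%g A /\ on_chain (s * tperm x y)%g C.
  by rewrite !tF ?chA ?chC ?xC ?yC // (negPf xA) (negPf yA).
rewrite chA' chC'; apply/forall_inP => X XF; apply/implyP => chX.
have sFX xyX := implyP (sF X XF) (etrans (esym (tF X xyX)) chX).
(* Two sets on one chain are comparable. If [X] lies inside [A] it contains neither [x] nor [y]; if
   it contains [C] it contains both. Either way it was on the old chain already. *)
apply/andP; split.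
  have [|/ltnW] := leqP #|A| #|X|; first exact: on_chain_sub chA' chX.
  move/(on_chain_sub chX chA') => sXA.
  suff /andP[]: (A \subset X) && (X \subset C) by [].
  apply: sFX; rewrite (contraNF (subsetP sXA x)) //.
  by rewrite (contraNF (subsetP sXA y)).
have [|/ltnW] := leqP #|X| #|C|; first exact: on_chain_sub chX chC'.
move/(on_chain_sub chC' chX) => sCX.
suff /andP[]: (A \subset X) && (X \subset C) by [].
by apply: sFX; rewrite !(subsetP sCX).
Qed.

Definition hits (s : 'S_n) := #|[set X in F | on_chain s X]|.

Hypothesis freeF : ~ has_configuration F.

Lemma hits_chains_between A C : A \in F -> C \in F ->
  (\sum_(s in chains_between A C) hits s <= 4 * #|chains_between A C|)%N.
Proof.
move=> AF CF; set S := chains_between A C.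
have [->|[s0 s0S]] := set_0Vmem S; first by rewrite big_set0.
have sAC : A \subset C.
  move: s0S; rewrite inE => /and3P[_ chC /forall_inP/(_ C CF)/implyP/(_ chC)].
  by case/andP.
pose G := [set X in F | (A \subset X) && (X \subset C)].
pose a := #|A|; pose m := (#|C| - a)%N.
have le_aC : (a <= #|C|)%N by apply: subset_leq_card.
(* The order of summation is exchanged; members of [F] outside the interval lie on no chain of the
   class. *)
have -> : (\sum_(s in S) hits s = \sum_(X in G) #|[set s in S | on_chain s X]|)%N.
  rewrite /hits; under eq_bigr do rewrite -sum1dep_card big_mkcondr.
  rewrite exchange_big /= [RHS]big_mkcond [LHS]big_mkcond /=; apply: eq_bigr => X _.
  rewrite inE; case: (boolP (X \in F)) => //= XF.
  rewrite -big_mkcondr sum1dep_card; case: ifPn => // nACX.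
  apply/eqP; rewrite cards_eq0; apply/eqP/setP=> s; rewrite !inE.
  apply/negP=> /andP[/and3P[_ _ /forall_inP/(_ X XF)/implyP sX] /sX].
  by apply/negP.
rewrite -(ler_nat rat) natr_sum natrM.
have cardX X : X \in G ->
    #|[set s in S | on_chain s X]|%:R = #|S|%:R * ('C(m, #|X| - a)%:R)^-1 :> rat.
  rewrite inE => /and3P[_ sAX sXC].
  have <- : (#|[set s in S | on_chain s X]| * 'C(m, #|X| - a))%N = #|S|.
    apply: card_on_chain => //.
    - by move=> s; rewrite inE => /and3P[-> ->].
    - by move=> s x y sS xCA yCA; apply: chains_between_tperm.
  rewrite natrM mulfK // pnatr_eq0 -lt0n bin_gt0 leq_sub2r //.
  exact: subset_leq_card.
rewrite (eq_bigr _ cardX) -mulr_sumr mulrC ler_wpM2r ?ler0n //.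
(* Levels are now counted from [A], so that [j] stands for [#|X| - a] and runs from 0 to [m]. *)
rewrite (sum_by_card (fun k => ('C(m, k - a)%:R)^-1) (lo := a) (hi := (m.+1 + a)%N)).
  rewrite -{1}[a]add0n big_addn addnK big_mkord.
  under eq_bigr do rewrite addnK.
  pose f j := #|[set X in G | #|X| == j + a]|%N.
  have fE j : f j = #|[set X in F | [&& A \subset X, X \subset C & #|X| == j + a]]|%N.
    by apply: eq_card => X; rewrite !inE -!andbA.
  apply: (sum_bin_ratio_le4 (f := f)) => j; rewrite fE.
    have := card_interval sAC (leq_addl j a); rewrite addnK => <-.
    by apply/subset_leq_card/subsetP=> X; rewrite !inE => /andP[].
  by move=> jm; apply: configuration_free_level => //; rewrite -/a /m in jm *; lia.
move=> X; rewrite inE => /and3P[_ /subset_leq_card leaX /subset_leq_card leXC].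
by rewrite leaX /m; rewrite /a in le_aC *; lia.
Qed.

(** Each chain meeting [F] belongs to exactly one class with ends in [F], and the other chains
    contribute 0, so the bounds for the classes add up. *)
Lemma sum_hits : (\sum_s hits s <= 4 * #|{: 'S_n}|)%N.
Proof.
have hits_between (s : 'S_n) : (hits s
    <= \sum_(p in setX F F | s \in chains_between p.1 p.2) hits s)%N.
  have [->|] := posnP (hits s); first by [].
  rewrite card_gt0 => /set0Pn[X0]; rewrite inE => X0P.
  pose P X := (X \in F) && on_chain s X; pose size_of (X : {set 'I_n}) := #|X|.
  case: (@arg_minnP _ X0 P size_of X0P) => A /andP[AF chA] Amin.
  case: (@arg_maxnP _ X0 P size_of X0P) => C /andP[CF chC] Cmax.
  rewrite (bigD1 (A, C)) ?leq_addr //= in_setX AF CF inE chA chC /=.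
  apply/forall_inP => X XF; apply/implyP => chX.
  rewrite (on_chain_sub chA chX) ?(on_chain_sub chX chC) //.
    by apply: Cmax; rewrite /P XF.
  by apply: Amin; rewrite /P XF.
have uniq_between (s : 'S_n) :
    (#|[set p in setX F F | s \in chains_between p.1 p.2]| <= 1)%N.
  apply/card_le1_eqP=> -[A C] [A' C']; rewrite !inE /=.
  move=> /andP[/andP[AF CF] /and3P[chA chC /forall_inP sF]].
  move=> /andP[/andP[AF' CF'] /and3P[chA' chC' /forall_inP sF']].
  (* Each pair of ends bounds the other, so the two pairs coincide. *)
  have [/andP[sA _] /andP[_ sC]] := (implyP (sF _ AF') chA', implyP (sF _ CF') chC').
  have [/andP[sA' _] /andP[_ sC']] := (implyP (sF' _ AF) chA, implyP (sF' _ CF) chC).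
  by congr (_, _); apply/eqP; rewrite eqEsubset ?sA ?sA' ?sC ?sC'.
apply: leq_trans (leq_sum _ (fun s _ => hits_between s)) _.
rewrite (exchange_big_dep (mem (setX F F))) /=; last by move=> s p _ /andP[].
apply: (@leq_trans (\sum_(p in setX F F) 4 * #|chains_between p.1 p.2|)).
  apply: leq_sum => -[A C]; rewrite in_setX => /andP[/= AF CF].
  rewrite (eq_bigl (mem (chains_between A C))) ?hits_chains_between // => s /=.
  by rewrite AF CF.
rewrite -big_distrr leq_mul2l /=; under eq_bigr do rewrite -sum1_card.
rewrite (exchange_big_dep xpredT) //= -sum1_card; apply: leq_sum => s _.
apply: leq_trans (uniq_between s); rewrite sum1_card; apply/eq_leq/eq_card => p.
by rewrite [RHS]inE.
Qed.

(** Between [set0] and [setT], with all permutations allowed, each summand is the fraction of chains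
    through [X]; the sum is thus the average of [hits]. *)
Lemma LYM_configuration_free : \sum_(X in F) ('C(n, #|X|)%:R)^-1 <= 4 :> rat.
Proof.
have fact_gt0 : 0 < #|{: 'S_n}|%:R :> rat.
  by rewrite ltr0n; apply/card_gt0P; exists 1%g.
have cardX X : #|[set s in [set: 'S_n] | on_chain s X]|%:R
    = #|{: 'S_n}|%:R * ('C(n, #|X|)%:R)^-1 :> rat.
  have := @card_on_chain n setT set0 setT X.
  rewrite !cardsT cards0 !subn0 card_ord => <-; rewrite ?sub0set ?subsetT //.
  - rewrite natrM mulfK // pnatr_eq0 -lt0n bin_gt0.
    by rewrite -[X in (_ <= X)%N]card_ord max_card.
  - by move=> s _; rewrite on_chain0 on_chainT.
  - by move=> s x y; rewrite !inE.
rewrite -(ler_pM2l fact_gt0) mulr_sumr; under eq_bigr do rewrite -cardX.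
rewrite -natr_sum -natrM ler_nat mulnC; apply: leq_trans sum_hits.
apply/eq_leq; rewrite /hits.
under eq_bigr do rewrite -sum1dep_card big_mkcondr.
under [RHS]eq_bigr do rewrite -sum1dep_card big_mkcondr.
by rewrite [RHS]exchange_big /=; apply: eq_bigr => X _; apply: eq_bigl => s; rewrite inE.
Qed.

End ConfigurationFree.

(** * The four middle levels: size, comparison and extremality *)

Lemma card_level_middle n k :
    (uphalf (n - 4) <= k < uphalf (n + 4))%N ->
  #|[set X in middle_levels n 4 | #|X| == k]| = 'C(n, k).
Proof.
move=> k_mid; rewrite -[in RHS](card_ord n) -cardsT -cards_draws.
by apply: eq_card => X; rewrite !inE subsetT; case: eqP => [->|]; rewrite ?k_mid ?andbF.
Qed.

Lemma sum_middle_levels n (g : nat -> rat) :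
  \sum_(X in middle_levels n 4) g #|X|
    = \sum_(uphalf (n - 4) <= k < uphalf (n + 4)) 'C(n, k)%:R * g k.
Proof.
rewrite (sum_by_card g (lo := uphalf (n - 4)) (hi := uphalf (n + 4))).
  by apply: eq_big_nat => k k_mid; rewrite card_level_middle.
by move=> X; rewrite inE.
Qed.

Lemma card_middle_levels n : #|middle_levels n 4| = Sigma n 4.
Proof.
apply/eqP; rewrite -(eqr_nat rat) /Sigma -sum1_card !natr_sum.
rewrite (sum_middle_levels n (fun=> 1)).
by apply/eqP/eq_bigr => k _; rewrite mulr1.
Qed.

(** Each full level contributes 1. From [n = 3] on, where the levels are 0 to 3, the range has four
    levels, all at most [n]. *)
Lemma LYM_middle_levels n : (3 <= n)%N ->
  \sum_(X in middle_levels n 4) ('C(n, #|X|)%:R)^-1 = 4 :> rat.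
Proof.
move=> n3; rewrite (sum_middle_levels n (fun k => ('C(n, k)%:R)^-1)).
rewrite (eq_big_nat _ _ (F2 := fun=> 1)).
  by rewrite sumr_const_nat; congr (_%:R); lia.
by move=> k k_mid; rewrite mulfV // pnatr_eq0 -lt0n bin_gt0; lia.
Qed.

(* With [c] the least binomial coefficient of a middle level, [c / 'C(n, #|X|)]
   is at most [1] on the middle levels and at least [1] off them. *)
Lemma card_le_Sigma n (F : {set {set 'I_n}}) : (3 <= n)%N ->
    \sum_(X in F) ('C(n, #|X|)%:R)^-1 <= 4 :> rat ->
  (#|F| <= Sigma n 4)%N.
Proof.
move=> n3 lymF; rewrite -card_middle_levels; set M := middle_levels n 4.
pose c : rat := 'C(n, uphalf (n - 4))%:R.
pose w (X : {set 'I_n}) : rat := c * ('C(n, #|X|)%:R)^-1.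
have card_n (X : {set 'I_n}) : (#|X| <= n)%N.
  by rewrite -[X in (_ <= X)%N]card_ord max_card.
have bin_n (X : {set 'I_n}) : 0 < 'C(n, #|X|)%:R :> rat by rewrite ltr0n bin_gt0.
have w_in X : X \in M -> w X <= 1.
  rewrite inE => midX; rewrite ler_pdivrMr // mul1r ler_nat bin_middle_mono //; lia.
have w_out X : X \notin M -> 1 <= w X.
  rewrite inE => midX; rewrite ler_pdivlMr // mul1r ler_nat.
  have [le_Xlo|lt_loX] := leqP #|X| (uphalf (n - 4)).
    by rewrite bin_middle_mono //; lia.
  by rewrite -bin_sub // bin_middle_mono //; have := card_n X; lia.
have sum_w : \sum_(X in F) w X <= \sum_(X in M) w X.
  by rewrite -!mulr_sumr LYM_middle_levels // ler_wpM2l ?ler0n.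
(* The common part of [F] and [M] cancels; the terms of [F] off [M] are at most 0, those of [M] off
   [F] at least 0. Adding [sum_w] then compares the cardinalities. *)
have leFM : \sum_(X in F) (1 - w X) <= \sum_(X in M) (1 - w X).
  rewrite (big_setID M) [leRHS](big_setID F) /= setIC -[leRHS]addr0 -addrA lerD2l.
  rewrite -subr_ge0 addr0 subr_ge0; apply: (@le_trans _ _ 0).
    by apply: sumr_le0 => X; rewrite inE => /andP[/w_out wX _]; rewrite subr_le0.
  by apply: sumr_ge0 => X; rewrite inE => /andP[_ /w_in wX]; rewrite subr_ge0.
rewrite -(ler_nat rat) -!sum1_card !natr_sum.
by move: leFM; rewrite !sumrB; lra.
Qed.

(** Within four levels [#|C| - #|A|] is at most 3, so a level strictly between [A] and [C] has at
    most ['C(3, 1) = 3] sets, too few for the four [B i]. *)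
Lemma middle_levels_configuration_free n : ~ has_configuration (middle_levels n 4).
Proof.
case=> A [C] [B] [uniqABC subM incl cardB].
have midA : A \in middle_levels n 4 by apply: subM; rewrite inE eqxx.
have midC : C \in middle_levels n 4 by apply: subM; rewrite !inE eqxx orbT.
have Bcod i : B i \in codom B by apply: codom_f.
move: uniqABC => /= /and3P[]; rewrite inE negb_or => /andP[_ AB] CB uniqB.
have injB : injective B by apply/injectiveP.
have ltA i : (#|A| < #|B i|)%N.
  apply: proper_card; rewrite properEneq (proj1 (incl i)) andbT.
  by apply: contraNneq AB => ->.
have ltC i : (#|B i| < #|C|)%N.
  apply: proper_card; rewrite properEneq (proj2 (incl i)) andbT.
  by apply: contraNneq CB => <-.
have sAC : A \subset C := subset_trans (proj1 (incl ord0)) (proj2 (incl ord0)).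
have : (#|B @: setT| <= 'C(#|C| - #|A|, #|B ord0| - #|A|))%N.
  rewrite -card_interval //; last exact: ltnW.
  apply/subset_leq_card/subsetP=> _ /imsetP[i _ ->]; rewrite inE.
  by have [-> ->] := incl i; rewrite (cardB i ord0) eqxx.
rewrite card_imset // cardsT card_ord.
have := ltA ord0; have := ltC ord0; move: midA midC; rewrite !inE.
move: #|A| #|B ord0| #|C| => a b c midA midC ltbc ltab.
have : (c - a <= 3)%N && (0 < b - a < c - a)%N by lia.
by move: (c - a)%N (b - a)%N => [|[|[|[|?]]]] [|[|[|?]]].
Qed.

Close Scope ring_scope.

Theorem theorem2p23 (n : nat) (hn : 3 <= n) :
  (forall F : {set {set 'I_n}}, ~ has_configuration F -> #|F| <= Sigma n 4)
  /\ (#|middle_levels n 4| = Sigma n 4 /\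
      ~ has_configuration (middle_levels n 4)).
Proof.
split; first by move=> F freeF; apply/card_le_Sigma/LYM_configuration_free.
by split; [apply: card_middle_levels | apply: middle_levels_configuration_free].
Qed.
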